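(* For a metric space $X$, the following conditions are equivalent: (1) $X$ is a Lipschitz image of an injective metric space; (2) $X$ is a Lipschitz image of a complete $\mathbb{R}$-tree; (3) $X$ is Lipschitz connected.
   Context: The metric of a metric space $X$ is denoted $d_X$. For a map $f:X\to Y$ between metric spaces, $\operatorname{Lip}(f):=\sup_{x\ne x'}\frac{d_Y(f(x),f(x'))}{d_X(x,x')}\in[0,\infty]$ (with $\sup\varnothing=0$). The map $f$ is Lipschitz if $\operatorname{Lip}(f)<\infty$, and $L$-Lipschitz (for a real number $L$) if $\operatorname{Lip}(f)\le L$. A metric space $Y$ is a Lipschitz image of a metric space $X$ if there exists a surjective Lipschitz map $X\to Y$. A metric space $X$ is injective if every $1$-Lipschitz map $f:B\to X$ defined on a subspace $B$ of a metric space $A$ extends to a $1$-Lipschitz map $\bar f:A\to X$. For points $x,y$ of a metric space $X$, the metric segment is $[x,y]:=\{z\in X:d_X(x,y)=d_X(x,z)+d_X(z,y)\}$. A metric space $X$ is an $\mathbb{R}$-tree if for all $x,y\in X$ the metric segment $[x,y]$ is isometric to the interval $[0,d_X(x,y)]$ of the real line, and for all $x,y,z\in X$ with $[x,y]\cap[y,z]=\{y\}$ we have $d_X(x,z)=d_X(x,y)+d_X(y,z)$. A metric space $X$ is Lipschitz connected if for all points $x,y\in X$ there exists a Lipschitz map $f:[0,1]\to X$ with $f(0)=x$ and $f(1)=y$.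
   Formalization: The metric space X is assumed nonempty; for empty X conditions (2) and (3) hold, but (1) fails because the empty metric space is not injective. *)

(* Defs.v *)
From HB Require Import structures.
From mathcomp Require Import all_boot all_order all_algebra.
From mathcomp Require Import all_classical all_reals all_analysis.

Set Implicit Arguments.
Unset Strict Implicit.
Unset Printing Implicit Defensive.
Import Order.TTheory GRing.Theory Num.Theory.
Local Open Scope classical_set_scope.
Local Open Scope ring_scope.

(* A subset of a metric space, seen as a type, carries the restricted metric;
   the library provides its pseudometric structure. *)
Section subspace_metric.
Context {R : realType} {X : metricType R} (A : set X).

Let sub_mdist (x y : A) : R := mdist (val x) (val y).

Let sub_mdist_ge0 (x y : A) : 0 <= sub_mdist x y.
Proof. exact: mdist_ge0. Qed.

Let sub_mdist_positivity (x y : A) : sub_mdist x y = 0 -> x = y.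
Proof. by move=> /mdist_positivity /val_inj. Qed.

Let sub_ballEmdist (x : A) (d : R) : ball x d = [set y | sub_mdist x y < d].
Proof.
by rewrite -initial_ballE ballEmdist.
Qed.

HB.instance Definition _ := PseudoMetric_isMetric.Build R (set_type A)
  sub_mdist_ge0 sub_mdist_positivity sub_ballEmdist.
End subspace_metric.

Section lipschitz_maps.
Context {R : realType}.
Implicit Types X Y : metricType R.

(* [ereal_sup set0 = -oo], whereas here the supremum of the empty set is 0;
   adding 0 to the set has no other effect, as all the ratios are >= 0. *)
Definition Lip X Y (f : X -> Y) : \bar R :=
  ereal_sup (0%E |` [set (mdist (f p.1) (f p.2) / mdist p.1 p.2)%:E
                      | p in [set p : X * X | p.1 != p.2]]).

Definition Lipschitz X Y (f : X -> Y) : Prop := (Lip f < +oo)%E.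

Definition LLipschitz (L : R) X Y (f : X -> Y) : Prop := (Lip f <= L%:E)%E.

Definition Lipschitz_image X Y : Prop :=
  exists2 f : X -> Y, Lipschitz f & set_surj [set: X] [set: Y] f.

Definition isometric X Y : Prop :=
  exists2 f : X -> Y, (forall x x', mdist (f x) (f x') = mdist x x')
                    & set_surj [set: X] [set: Y] f.

End lipschitz_maps.

Section spaces.
Context {R : realType}.
Implicit Types X : metricType R.

Definition injective_space X : Prop :=
  forall (A : metricType R) (B : set A) (f : B -> X), LLipschitz 1 f ->
  exists2 g : A -> X, LLipschitz 1 g & forall b : B, g (val b) = f b.

Definition complete_space X : Prop :=
  forall F : set_system X, ProperFilter F -> cauchy F -> exists x : X, F --> x.

Definition segment X (x y : X) : set X :=
  [set z | mdist x y = mdist x z + mdist z y].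

(* R as a metric space is [R^o]. *)
Definition real_interval (a b : R) : set R^o := `[a, b].

Definition Rtree X : Prop :=
  (forall x y : X, isometric (segment x y) (real_interval 0 (mdist x y))) /\
  (forall x y z : X, segment x y `&` segment y z = [set y] ->
     mdist x z = mdist x y + mdist y z).

Lemma mem0_interval01 : (0 : R^o) \in real_interval 0 1.
Proof. by rewrite inE /real_interval/= in_itv/= lexx ler01. Qed.

Lemma mem1_interval01 : (1 : R^o) \in real_interval 0 1.
Proof. by rewrite inE /real_interval/= in_itv/= lexx ler01. Qed.

Definition Lipschitz_connected X : Prop :=
  forall x y : X, exists f : real_interval 0 1 -> X,
    [/\ Lipschitz f, f (exist _ 0 mem0_interval01) = x
                   & f (exist _ 1 mem1_interval01) = y].

End spaces.

(* Main.v *)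
(* Lipschitz connectedness passes to Lipschitz images. Complete R-trees have it
   because segments are isometric to intervals, and injective spaces because an
   isometric embedding of {0, d(x, y)} extends to the real line. Conversely, let
   X be Lipschitz connected and fix x0 in X. The hedgehog obtained by gluing at
   0 one ray [0, +oo[ per point x of X is both a complete R-tree and injective;
   sending the ray of x to a 1-Lipschitz path from x0 through x gives a
   1-Lipschitz surjection onto X, since the distance between points of
   different rays is the sum of their heights. *)
From HB Require Import structures.
Require Import Defs.
From mathcomp Require Import all_boot all_order all_algebra.
From mathcomp Require Import all_classical all_reals all_analysis.
From mathcomp Require Import lra.
Import Order.TTheory GRing.Theory Num.Theory.
Local Open Scope classical_set_scope.
Local Open Scope ring_scope.

(** * Lipschitz maps as pointwise inequalities *)

(** The hypothesis [0 <= L] answers to the 0 adjoined to the supremum in [Lip]: on a one-point space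
    the inequality holds for every [L], yet [Lip f] is 0. *)
Lemma LLipschitzP (R : realType) (X Y : metricType R) (L : R) (f : X -> Y) :
  0 <= L ->
  LLipschitz L f <-> forall x x', mdist (f x) (f x') <= L * mdist x x'.
Proof.
move=> L0; split=> [fL x x'|fL].
- have [->|xx'] := eqVneq x x'; first by rewrite !mdistxx mulr0.
  rewrite -ler_pdivrMr ?mdist_gt0// -lee_fin; apply: le_trans fL.
  by apply: ereal_sup_ubound; right; exists (x, x').
- apply: ge_ereal_sup => _ [->|[[x x'] /= xx' <-]]; rewrite lee_fin//.
  by rewrite ler_pdivrMr ?mdist_gt0.
Qed.

Lemma LLipschitz1P (R : realType) (X Y : metricType R) (f : X -> Y) :
  LLipschitz 1 f <-> forall x x', mdist (f x) (f x') <= mdist x x'.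
Proof.
rewrite LLipschitzP//.
by split=> fL x x'; have := fL x x'; rewrite mul1r.
Qed.

Lemma LipschitzP (R : realType) (X Y : metricType R) (f : X -> Y) :
  Lipschitz f <->
  exists2 L, 0 < L & forall x x', mdist (f x) (f x') <= L * mdist x x'.
Proof.
split=> [fL|[L L0 /(LLipschitzP _ _ _ _ _ (ltW L0)) fL]]; last first.
  exact: le_lt_trans fL (ltry _).
have Lip0 : (0 <= Lip f)%E by apply: ereal_sup_ubound; left.
have LipE : Lip f = (fine (Lip f))%:E by rewrite fineK// ge0_fin_numE.
(* Adding 1 keeps the constant positive when [f] is constant, so that later proofs may divide by
   it. *)
exists (fine (Lip f) + 1); first by rewrite ltr_wpDl// fine_ge0.
apply/LLipschitzP; first by rewrite addr_ge0// fine_ge0.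
by rewrite /LLipschitz [leLHS]LipE lee_fin lerDl.
Qed.

(** * Lipschitz paths and the implications towards Lipschitz connectedness *)

Lemma clamp_contraction (R : realFieldType) (u v : R) :
  `|Num.max 0 (Num.min 1 v) - Num.max 0 (Num.min 1 u)| <= `|u - v|.
Proof.
case: (leP 1 v) => ?; case: (leP 1 u) => ?; rewrite ?(max_r ler01);
  try case: (leP 0 v) => ?; try case: (leP 0 u) => ?;
  by repeat case: ger0P => ?; lra.
Qed.

(** An [L]-Lipschitz path on [0, 1], run at speed [1 / L] and prolonged by constants on both sides,
    is 1-Lipschitz on the whole line and reaches [y] at time [L]. *)
Lemma Lipschitz_connected_path (R : realType) (X : metricType R) (x y : X) :
  Lipschitz_connected X ->
  exists c : R -> X, [/\ forall s t, mdist (c s) (c t) <= `|s - t|,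
    c 0 = x & exists2 t, 0 <= t & c t = y].
Proof.
move=> /(_ x y)[f [/LipschitzP[L L0 fL] f0 f1]].
pose clamp (t : R) : R^o := Num.max 0 (Num.min 1 (t / L)).
have clampP t : clamp t \in @real_interval R 0 1.
  rewrite inE /real_interval /= in_itv /= /clamp.
  by rewrite le_max lexx /= ge_max ler01 ge_min lexx.
exists (fun t => f (exist _ (clamp t) (clampP t))); split=> [s t||].
- apply: le_trans (fL _ _) _.
  have -> : `|s - t| = L * `|s / L - t / L|.
    rewrite -mulrBl normrM (gtr0_norm (x := L^-1)) ?invr_gt0//.
    by rewrite mulrCA mulfV ?mulr1// gt_eqF.
  rewrite ler_pM2l//.
  change (`|clamp t - clamp s| <= `|s / L - t / L|).
  exact: clamp_contraction.
- rewrite -f0; congr f; apply: val_inj => /=.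
  by rewrite /clamp mul0r min_r// maxxx.
- exists L; first exact: ltW.
  rewrite -f1; congr f; apply: val_inj => /=.
  by rewrite /clamp divff ?gt_eqF// minxx max_r.
Qed.

Lemma Lipschitz_image_connected (R : realType) (X Y : metricType R) :
  Lipschitz_connected X -> Lipschitz_image X Y -> Lipschitz_connected Y.
Proof.
move=> Xc [f /LipschitzP[L L0 fL] fsurj] y y'.
have [x _ <-] := fsurj y I; have [x' _ <-] := fsurj y' I.
have [g [/LipschitzP[M M0 gM] g0 g1]] := Xc x x'.
exists (f \o g); split; rewrite /= ?g0 ?g1//.
apply/LipschitzP; exists (L * M); first exact: mulr_gt0.
by move=> s t; rewrite -mulrA (le_trans (fL _ _))// ler_pM2l.
Qed.

Lemma injective_Lipschitz_connected (R : realType) (Y : metricType R) :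
  injective_space Y -> Lipschitz_connected Y.
Proof.
move=> Yinj x y; pose D := mdist x y.
pose B : set R^o := [set 0; D].
pose f (b : B) : Y := if val b == 0 then x else y.
have f1 : LLipschitz 1 f.
  apply/LLipschitz1P => -[a aB] [b bB]; rewrite /f /=.
  change (mdist (if a == 0 then x else y) (if b == 0 then x else y)
     <= `|b - a|).
  move: aB bB; rewrite !inE => aB bB.
  have D0 : 0 <= D := mdist_ge0 _ _.
  have [a0|a0] := eqVneq a 0; have [b0|b0] := eqVneq b 0;
    rewrite ?mdistxx//.
  - by case: bB b0 => [-> /eqP//|-> _]; rewrite a0 subr0 ger0_norm.
  - case: aB a0 => [-> /eqP//|-> _].
    by rewrite b0 sub0r normrN ger0_norm// metric_sym.
have [g /LLipschitz1P g1 gf] := Yinj _ _ _ f1.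
exists (fun t => g (D * val t)); split.
(* [D] itself may be 0, whereas [LipschitzP] asks for a positive constant. *)
- apply/LipschitzP; exists (D + 1).
    by rewrite ltr_wpDl// mdist_ge0.
  move=> s t; apply: le_trans (g1 _ _) _.
  change (`|D * val t - D * val s| <= (D + 1) * `|val t - val s|).
  rewrite -mulrBr normrM ger0_norm ?mdist_ge0//.
  by rewrite ler_wpM2r// lerDl.
- have B0 : (0 : R^o) \in B by rewrite inE; left.
  by rewrite /= mulr0 (gf (exist _ 0 B0)) /f /= eqxx.
- have BD : (D : R^o) \in B by rewrite inE; right.
  rewrite /= mulr1 (gf (exist _ D BD)) /f /=.
  (* If [D = 0], the value at [D] is [x], which then equals [y]. *)
  by case: eqP => // /mdist_positivity.
Qed.

Lemma Rtree_Lipschitz_connected (R : realType) (T : metricType R) :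
  Rtree T -> Lipschitz_connected T.
Proof.
move=> [Tseg _] x y; set D := mdist x y.
have D0 : 0 <= D := mdist_ge0 _ _.
have [f fiso fsurj] := Tseg x y.
have xP : x \in segment x y by rewrite inE /segment /= mdistxx add0r.
have yP : y \in segment x y by rewrite inE /segment /= mdistxx addr0.
pose X : segment x y := exist _ x xP; pose Y : segment x y := exist _ y yP.
have fxy : `|val (f Y) - val (f X)| = D by exact: (fiso X Y).
have itvP (u : real_interval 0 D) : 0 <= val u <= D.
  by case: u => u /= ; rewrite inE /real_interval /= in_itv.
(* The isometry may send [x] to either end of the interval, so the path interpolates affinely from
   [f X] to [f Y] and is pulled back through [f]. *)
pose c (t : real_interval 0 1) : R^o :=
  val (f X) + val t * (val (f Y) - val (f X)).
have cP t : c t \in real_interval 0 D.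
  rewrite inE /real_interval /= in_itv /= /c.
  have /andP[] : 0 <= (val t : R) <= 1.
    by case: t => t /=; rewrite inE /real_interval /= in_itv.
  have := itvP (f X); have := itvP (f Y).
  move: (val t) (val (f X)) (val (f Y)) => s a b /andP[? ?] /andP[? ?] ? ?.
  by apply/andP; split; nra.
have /choice[g gP] : forall t, exists z, f z = exist _ (c t) (cP t).
  by move=> t; have [z _ <-] := fsurj (exist _ (c t) (cP t)) I; exists z.
have finj u v : f u = f v -> u = v.
  by move=> fuv; apply: mdist_positivity; rewrite -fiso fuv mdistxx.
exists (fun t => val (g t)); split.
- apply/LipschitzP; exists (D + 1); first by rewrite ltr_wpDl.
  move=> s t; change (mdist (g s) (g t) <= (D + 1) * `|val t - val s|).
  rewrite -fiso !gP; change (`|c t - c s| <= (D + 1) * `|val t - val s|).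
  have -> : c t - c s = (val t - val s) * (val (f Y) - val (f X)).
    by rewrite /c; lra.
  by rewrite normrM fxy mulrC ler_wpM2r// lerDl.
- have -> // : g (exist _ 0 mem0_interval01) = X.
  by apply: finj; rewrite gP; apply: val_inj; rewrite /= /c /= mul0r addr0.
- have -> // : g (exist _ 1 mem1_interval01) = Y.
  by apply: finj; rewrite gP; apply: val_inj; rewrite /= /c /= mul1r addrC subrK.
Qed.

(** * Distances between points of rays glued at height 0 *)

Section spine_distance.
Context {R : realType} {I : choiceType}.
Implicit Types p q r m : I * R.

(** For nonnegative heights this is the length of the shortest way, through the centre if the rays
    differ. It is only a pseudometric: the pairs of height 0 are at distance 0 from each other. *)
Definition spine_dist p q : R :=
  if p.1 == q.1 then `|p.2 - q.2| else p.2 + q.2.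

Ltac spine_cases :=
  rewrite /spine_dist /=;
  repeat (case: eqVneq => [?|?]; [try subst|];
          try match goal with H : is_true (?x != ?x) |- _ =>
                by move: H; rewrite eqxx end).

Ltac norm_lra := repeat case: ger0P => ?; lra.

Lemma spine_dist_sym p q : spine_dist p q = spine_dist q p.
Proof. by rewrite /spine_dist eq_sym distrC (addrC p.2). Qed.

Lemma spine_dist_triangle q p r : 0 <= p.2 -> 0 <= q.2 -> 0 <= r.2 ->
  spine_dist p r <= spine_dist p q + spine_dist q r.
Proof.
case: p q r => [i a] [j b] [k c] /= a0 b0 c0.
by spine_cases; norm_lra.
Qed.

Lemma height_le_spine_dist p q : 0 <= p.2 -> 0 <= q.2 ->
  p.2 - q.2 <= spine_dist p q.
Proof.
by case: p q => [i a] [j b] /= a0 b0; spine_cases; norm_lra.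
Qed.

(** A point at the centre may carry any label, so [m] is replaced by an equivalent [m'] lying on the
    ray of [p] or of [q]. A point of positive height on a third ray would cost a detour. *)
Lemma spine_segmentP p q m : 0 <= p.2 -> 0 <= q.2 -> 0 <= m.2 ->
  spine_dist p q = spine_dist p m + spine_dist m q ->
  exists m', [/\ 0 <= m'.2,
    forall x, 0 <= x.2 -> spine_dist x m = spine_dist x m' &
    if p.1 == q.1
    then m'.1 = p.1 /\ (p.2 <= m'.2 <= q.2 \/ q.2 <= m'.2 <= p.2)
    else m'.1 = p.1 /\ m'.2 <= p.2 \/ m'.1 = q.1 /\ m'.2 <= q.2].
Proof.
case: p q m => [i a] [j b] [k c] /= a0 b0 c0.
have center l : c = 0 ->
    forall x : I * R, 0 <= x.2 -> spine_dist x (k, c) = spine_dist x (l, 0).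
  move=> -> x x0; rewrite /spine_dist /= subr0 addr0 ger0_norm//.
  by do 2!case: ifP.
have [<-|ij] := eqVneq i j.
  have [<-|ik] := eqVneq i k.
    rewrite /spine_dist /= !eqxx => abc; exists (i, c); split=> //; split=> //=.
    move: abc; have [ab|ab] := leP a b; repeat case: ger0P => ?;
      by move=> ?; first [by left; apply/andP; split; lra
        |by right; apply/andP; split; lra].
  rewrite /spine_dist /= eqxx (eq_sym k) (negPf ik) => abc.
  (* Going from one ray to another and back costs [a + b + 2c], which equals the distance of [a] and
     [b] only if [c] and one of [a], [b] vanish. *)
  have c1 : c = 0 by move: abc; norm_lra.
  have : a = 0 \/ b = 0.
    by move: abc; rewrite c1; case: ger0P => ? ?; [right|left]; lra.
  by exists (i, 0); split; [|exact: center|split=> //=; lra].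
have [<-|ik] := eqVneq i k.
  rewrite /spine_dist /= eqxx (negPf ij) => abc; exists (i, c); split=> //=.
  by left; split=> //; move: abc; norm_lra.
have [<-|jk] := eqVneq j k.
  rewrite /spine_dist /= eqxx (negPf ij) => abc; exists (j, c); split=> //=.
  by right; split=> //; move: abc; norm_lra.
rewrite /spine_dist /= (negPf ij) (negPf ik) (eq_sym k) (negPf jk) => abc.
have c1 : c = 0 by lra.
by exists (i, 0); split=> //; [exact: center|left].
Qed.

(** Once [m] and [r] are moved onto the rays of [p] and [q], their distances to [p] are affine in
    their heights. This makes the distance to [p] an isometry of the segment into the line. *)
Lemma spine_segment_isometry p q m r :
  0 <= p.2 -> 0 <= q.2 -> 0 <= m.2 -> 0 <= r.2 ->
  spine_dist p q = spine_dist p m + spine_dist m q ->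
  spine_dist p q = spine_dist p r + spine_dist r q ->
  `|spine_dist p r - spine_dist p m| = spine_dist m r.
Proof.
move=> p0 q0 m0 r0 /(spine_segmentP _ _ _ p0 q0 m0)[[k c] /= [c0 mE mP]].
move=> /(spine_segmentP _ _ _ p0 q0 r0)[[l d] /= [d0 rE rP]].
rewrite !rE// mE// (spine_dist_sym m) mE//.
case: p q p0 q0 mP rP {mE rE} => [i a] [j b] /= a0 b0.
have [_|ij] := eqVneq i j.
  move=> [-> mP] [-> rP]; rewrite /spine_dist /= eqxx.
  have [ab|ab] := leP a b.
    have [ac ad] : a <= c /\ a <= d by move: mP rP; lra.
    rewrite !(distrC a) !(ger0_norm (_ : 0 <= _ - a)) ?subr_ge0//.
    by congr `| _ |; lra.
  have [ca da] : c <= a /\ d <= a by move: mP rP; lra.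
  rewrite (distrC d) !(ger0_norm (_ : 0 <= a - _)) ?subr_ge0//.
  by congr `| _ |; lra.
have ji : j != i by rewrite eq_sym.
rewrite /spine_dist /=.
move=> [[-> cP]|[-> cP]] [[-> dP]|[-> dP]]; rewrite ?eqxx ?(negPf ij) ?(negPf ji).
- rewrite (distrC d) !(ger0_norm (_ : 0 <= a - _)) ?subr_ge0//.
  by congr `| _ |; lra.
- rewrite (ger0_norm (_ : 0 <= a - _)) ?subr_ge0//.
  by rewrite ger0_norm; lra.
- rewrite (ger0_norm (_ : 0 <= a - _)) ?subr_ge0//.
  by rewrite ler0_norm; lra.
- by congr `| _ |; lra.
Qed.

(** Walk a length [c] from [p] towards [q]: along the common ray, or down to the centre and then,
    once [a] is used up, up the ray of [q]. *)
Lemma spine_segment_point p q (c : R) : 0 <= p.2 -> 0 <= q.2 ->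
  0 <= c <= spine_dist p q -> exists m,
  [/\ 0 <= m.2, spine_dist p m = c & spine_dist m q = spine_dist p q - c].
Proof.
case: p q => [i a] [j b] /= a0 b0; rewrite /spine_dist /= => /andP[c0].
have [<-|ij] := eqVneq i j.
  have [ab|ab] := leP a b.
    rewrite distrC ger0_norm ?subr_ge0// => cD; exists (i, a + c).
    by rewrite /= eqxx; split; [lra|norm_lra|norm_lra].
  rewrite gtr0_norm ?subr_gt0// => cD; exists (i, a - c).
  by rewrite /= eqxx; split; [lra|norm_lra|norm_lra].
have [ca|ca] := leP c a => cD.
  exists (i, a - c); rewrite /= eqxx (negPf ij).
  by split; [lra|norm_lra|norm_lra].
exists (j, c - a); rewrite /= eqxx (negPf ij).
by split; [lra|norm_lra|norm_lra].
Qed.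

(** The branch point of the tripod spanned by [p], [q], [r]: the centre if the rays are distinct,
    the lower of the two points if just two share a ray, the point of median height if all three
    do. *)
Lemma spine_median p q r : 0 <= p.2 -> 0 <= q.2 -> 0 <= r.2 -> exists m,
  [/\ 0 <= m.2, spine_dist p q = spine_dist p m + spine_dist m q,
    spine_dist q r = spine_dist q m + spine_dist m r &
    spine_dist p r = spine_dist p m + spine_dist m r].
Proof.
case: p q r => [i a] [j b] [k c] /= a0 b0 c0.
have between (x y z : R) : (x <= y <= z) || (z <= y <= x) ->
    `|x - z| = `|x - y| + `|y - z|.
  move=> /orP[]/andP[xy yz].
    by rewrite !ler0_norm ?subr_le0// ?(le_trans xy)//; lra.
  by rewrite !ger0_norm ?subr_ge0// ?(le_trans xy)//; lra.
have lower (x y : R) : 0 <= x -> 0 <= y -> exists z : R, [/\ 0 <= z,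
    `|x - y| = `|x - z| + `|z - y|,
    `|x - z| = x - z /\ `|z - x| = x - z &
    `|y - z| = y - z /\ `|z - y| = y - z].
  move=> x0 y0; have [xy|yx] := leP x y; [exists x|exists y];
    rewrite subrr normr0.
    have -> : `|x - y| = y - x by rewrite ler0_norm; lra.
    have -> : `|y - x| = y - x by rewrite ger0_norm; lra.
    by repeat split; lra.
  have -> : `|x - y| = x - y by rewrite ger0_norm; lra.
  have -> : `|y - x| = x - y by rewrite ler0_norm; lra.
  by repeat split; lra.
have [?|ij] := eqVneq i j; [subst|]; last first.
  have [?|ik] := eqVneq i k; [subst|]; last first.
    have [?|jk] := eqVneq j k; [subst|]; last first.
      by exists (i, 0); split => //=; spine_cases; norm_lra.
    have [m [m0 ? [? ?] [? ?]]] := lower b c b0 c0.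
    by exists (k, m); split => //=; spine_cases; lra.
  have [m [m0 ? [? ?] [? ?]]] := lower a c a0 c0.
  by exists (k, m); split => //=; spine_cases; lra.
have [?|jk] := eqVneq j k; [subst|]; last first.
  have [m [m0 ? [? ?] [? ?]]] := lower a b a0 b0.
  by exists (j, m); split => //=; spine_cases; lra.
suff [m [m0 ? ? ?]] : exists m : R, [/\ 0 <= m,
    (a <= m <= b) || (b <= m <= a), (b <= m <= c) || (c <= m <= b) &
    (a <= m <= c) || (c <= m <= a)].
  by exists (k, m); rewrite /spine_dist /= eqxx; split=> //; exact: between.
wlog ab : a b a0 b0 / a <= b => [wl|].
  have [|/ltW ba] := leP a b; first exact: wl.
  have [m [m0 ? ? ?]] := wl _ _ b0 a0 ba.
  by exists m; split; rewrite // orbC.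
have [bc|/ltW cb] := leP b c.
  by exists b; rewrite b0 lexx ab bc.
have [ac|/ltW ca] := leP a c.
  by exists c; rewrite c0 lexx ac cb ?orbT.
by exists a; rewrite a0 lexx ab ca ?orbT.
Qed.
End spine_distance.

(* The rays [0, +oo[ indexed by I, glued at 0; the common endpoint is
   represented by (i0, 0) only. *)
Definition hedgehog (R : realType) {I : choiceType} (i0 : I) : Type :=
  {p : I * R | (0 <= p.2) && ((p.2 == 0) ==> (p.1 == i0))}.

HB.instance Definition _ (R : realType) (I : choiceType) (i0 : I) :=
  Choice.on (hedgehog R i0).

(** * The hedgehog as a complete, injective R-tree *)

Section hedgehog_metric.
Context {R : realType} {I : choiceType} (i0 : I).
Local Notation H := (hedgehog R i0).
Implicit Types x y : H.

Lemma height_ge0 x : 0 <= (val x).2.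
Proof. by case: x => p /= /andP[]. Qed.

Lemma spine_center x : (val x).2 = 0 -> (val x).1 = i0.
Proof. by case: x => p /= /andP[_ /implyP h] /eqP /h /eqP. Qed.

Definition hedgehog_dist x y : R := spine_dist (val x) (val y).

Lemma hedgehog_distxx x : hedgehog_dist x x = 0.
Proof. by rewrite /hedgehog_dist /spine_dist eqxx subrr normr0. Qed.

Lemma hedgehog_dist_positivity x y : hedgehog_dist x y = 0 -> x = y.
Proof.
rewrite /hedgehog_dist /spine_dist => xy; apply: val_inj.
have x0 := height_ge0 x; have y0 := height_ge0 y.
suff [h s] : (val x).2 = (val y).2 /\ (val x).1 = (val y).1.
  by rewrite [LHS]surjective_pairing h s -surjective_pairing.
move: xy; case: ifPn => [/eqP xy /normr0_eq0 /eqP|_ xy].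
  by rewrite subr_eq0 => /eqP.
have hx : (val x).2 = 0 by lra.
have hy : (val y).2 = 0 by lra.
by rewrite hx hy !spine_center.
Qed.

Lemma hedgehog_dist_sym x y : hedgehog_dist x y = hedgehog_dist y x.
Proof. exact: spine_dist_sym. Qed.

Lemma hedgehog_dist_triangle y x z :
  hedgehog_dist x z <= hedgehog_dist x y + hedgehog_dist y z.
Proof. by apply: spine_dist_triangle; exact: height_ge0. Qed.

HB.instance Definition _ := isMetric.Build R H hedgehog_distxx
  hedgehog_dist_positivity hedgehog_dist_sym hedgehog_dist_triangle.

Lemma hedgehog_mdistE x y : mdist x y = spine_dist (val x) (val y).
Proof. by []. Qed.

Lemma ray_subproof i (t : R) (t0 : 0 <= t) :
  let p := (if t == 0 then i0 else i, t) in
  (0 <= p.2) && ((p.2 == 0) ==> (p.1 == i0)).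
Proof. by rewrite /= t0 /=; apply/implyP => ->. Qed.

Definition ray i (t : R) (t0 : 0 <= t) : H :=
  exist _ (if t == 0 then i0 else i, t) (ray_subproof i t t0).

Lemma spine_dist_ray p i (t : R) (t0 : 0 <= t) : 0 <= p.2 ->
  spine_dist p (val (ray i t t0)) = spine_dist p (i, t).
Proof.
move=> p0; rewrite /spine_dist /=; have [->|//] := eqVneq t 0.
by rewrite subr0 addr0 ger0_norm//; do 2!case: ifP.
Qed.

Lemma mdist_ray x i (t : R) (t0 : 0 <= t) :
  mdist x (ray i t t0) = spine_dist (val x) (i, t).
Proof. by rewrite hedgehog_mdistE spine_dist_ray// height_ge0. Qed.

Lemma mdist_ray_ray i j (s t : R) (s0 : 0 <= s) (t0 : 0 <= t) :
  mdist (ray i s s0) (ray j t t0) = spine_dist (i, s) (j, t).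
Proof. by rewrite mdist_ray spine_dist_sym spine_dist_ray// spine_dist_sym. Qed.

(** Carries the witnesses found among pairs over to the hedgehog without changing distances. *)
Lemma hedgehog_point (p : I * R) : 0 <= p.2 ->
  exists x : H, forall y, mdist y x = spine_dist (val y) p.
Proof.
by case: p => i t /= t0; exists (ray i t t0) => y; rewrite mdist_ray.
Qed.

Lemma height_lipschitz x y : `|(val x).2 - (val y).2| <= mdist x y.
Proof.
rewrite ler_norml lerNl opprB [X in X && _](_ : _ = true).
  exact: height_le_spine_dist (height_ge0 x) (height_ge0 y).
rewrite metric_sym.
exact: height_le_spine_dist (height_ge0 y) (height_ge0 x).
Qed.

Lemma hedgehog_Rtree : Rtree H.
Proof.
split=> [x y|x y z xyz]; last first.
  have [p [p0 xyp yzp xzp]] :=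
    spine_median _ _ _ (height_ge0 x) (height_ge0 y) (height_ge0 z).
  have [m mE] := hedgehog_point p p0.
  have mE' w : spine_dist p (val w) = mdist m w.
    by rewrite metric_sym mE spine_dist_sym.
  (* The median of [x], [y], [z] lies on both segments, hence is [y], and it also lies between [x]
     and [z]. *)
  have my : m = y.
    suff : (segment x y `&` segment y z) m by rewrite xyz.
    by split; rewrite /segment /= mE -mE'.
  by rewrite -my mE -mE'.
have f_itv (z : segment x y) : mdist x (val z) \in real_interval 0 (mdist x y).
  case: z => z /=; rewrite !inE /segment /real_interval /= in_itv /= => ->.
  by rewrite mdist_ge0 lerDl mdist_ge0.
exists (fun z => exist _ (mdist x (val z) : R^o) (f_itv z)) => [z w|].
  change (`|mdist x (val w) - mdist x (val z)| = mdist (val z) (val w)).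
  rewrite !hedgehog_mdistE.
  apply: (@spine_segment_isometry _ _ (val x) (val y)); rewrite ?height_ge0//.
    by case: z => z /=; rewrite inE.
  by case: w => w /=; rewrite inE.
move=> [c cP] _.
have c_itv : 0 <= c <= mdist x y.
  by move: cP; rewrite inE /real_interval /= in_itv.
have [p [p0 xp py]] := spine_segment_point _ _ _ (height_ge0 x) (height_ge0 y) c_itv.
have [m mE] := hedgehog_point p p0.
have mP : m \in segment x y.
  rewrite inE /segment /= (metric_sym m) !mE (spine_dist_sym (val y)) xp py.
  by rewrite addrC subrK.
by exists (exist _ m mP) => //; apply: val_inj; rewrite /= mE.
Qed.

(** Heights are 1-Lipschitz, so they converge to some [r]. If [r = 0] the limit is the centre; if
    [r > 0] the points eventually stay on one ray. *)
Lemma hedgehog_complete : complete_space H.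
Proof.
move=> F FF Fc.
have {}Fc e : 0 < e -> exists p : H, \forall x \near F, mdist p x < e.
  move=> e0; have [p pF] := (cauchyP F).1 Fc e e0.
  by exists p; apply: filterS pF => x; rewrite ballEmdist.
pose h (x : H) : R^o := (val x).2.
have hc : cauchy (h @ F).
  apply: cauchy_exP => e e0; have [p pF] := Fc e e0.
  exists (h p); apply: filterS pF => x px; rewrite /= ballEmdist /=.
  apply: le_lt_trans px; rewrite metric_sym; exact: height_lipschitz.
have [r hr] : exists r : R, h @ F --> (r : R^o).
  by exists (lim (h @ F)); exact: cauchy_cvg hc.
have {}hr (e : R) : 0 < e -> \forall x \near F, `|(val x).2 - r| < e.
  move=> e0; have /cvgrPdist_lt := hr => /(_ e e0).
  by apply: filterS => x; rewrite distrC.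
have r0 : 0 <= r.
  rewrite leNgt; apply/negP => r0.
  have Nr0 : 0 < - r by lra.
  have [x] := filter_ex (hr _ Nr0); have := height_ge0 x.
  by rewrite ltr_norml => ? /andP[? ?]; lra.
suff [i iP] : exists i, forall e, 0 < e ->
    \forall x \near F, spine_dist (val x) (i, r) < e.
  exists (ray i r r0); apply/metricType_numDomainType.fcvgrPdist_lt => e e0.
  by apply: filterS (iP e e0) => x; rewrite metric_sym mdist_ray.
have [r00|rN0] := eqVneq r 0.
  exists i0 => e e0; apply: filterS (hr e e0) => x.
  rewrite r00 /spine_dist /= subr0 addr0 ger0_norm ?height_ge0//.
  by case: ifP.
have {}r0 : 0 < r by rewrite lt_neqAle eq_sym rN0.
(* A point within [r / 3] of [p] and of height above [2r / 3] is on the ray of [p]: from any other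
   ray its distance to [p] is at least its height. *)
have r3 : 0 < r / 3 by rewrite divr_gt0.
have [p pF] := Fc _ r3.
exists (val p).1 => e e0.
apply: filterS3 (hr e e0) (hr _ r3) pF => x xe x3 px.
rewrite /spine_dist /=.
suff -> : (val x).1 == (val p).1 by [].
move: px; rewrite hedgehog_mdistE /spine_dist eq_sym; case: ifP => // _ px.
have := height_ge0 p; move: x3; rewrite ltr_norml => /andP[? ?] ?.
by lra.
Qed.

(* McShane's formula extends the height; near a point where it is positive the
   values of f all lie on one ray, and this ray carries the extension. *)
Lemma hedgehog_injective : injective_space H.
Proof.
move=> A B f /LLipschitz1P f1.
have {}f1 (b b' : B) :
  spine_dist (val (f b)) (val (f b')) <= mdist (val b) (val b') := f1 b b'.
have f0 b : 0 <= (val (f b)).2 := height_ge0 (f b).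
have fB b b' : (val (f b)).2 - (val (f b')).2 <= mdist (val b) (val b').
  by apply: le_trans (f1 b b'); exact: height_le_spine_dist.
pose v a b : R := (val (f b)).2 - mdist a (val b).
(* The adjoined 0 keeps heights nonnegative and the set nonempty even if [B] is empty. *)
pose t a : R := sup (0 |` range (v a)).
have t_sup a : has_sup (0 |` range (v a)).
  split; first by exists 0; left.
  have [[b0 _]|noB] := pselect (exists b0 : B, True).
    exists ((val (f b0)).2 + mdist a (val b0)) => _ [->|[b _ <-]].
      by rewrite addr_ge0// mdist_ge0.
    have := fB b b0; have := metric_triangle (val b) a (val b0).
    by rewrite /v (metric_sym (val b) a); lra.
  by exists 0 => x [->//|[b _ _]]; case: noB; exists b.
have t0 a : 0 <= t a by apply: (sup_upper_bound (t_sup a)); left.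
have tv a b : v a b <= t a by apply: (sup_upper_bound (t_sup a)); right; exists b.
have t_le a c : 0 <= c -> (forall b, 0 < v a b -> v a b <= c) -> t a <= c.
  move=> c0 vc; apply: ge_sup => [|_ [->//|[b _ <-]]]; first by exists 0; left.
  have [/vc//|vb] := ltP 0 (v a b); exact: le_trans vb c0.
have t_lip a a' : t a - t a' <= mdist a a'.
  rewrite lerBlDl; apply: t_le => [|b _]; first by rewrite addr_ge0// mdist_ge0.
  have := tv a' b; have := metric_triangle a' a (val b).
  by rewrite /v (metric_sym a' a); lra.
(* When the values lie on different rays, their heights add up to at most the distance of [b] and
   [b'], which is bounded by passing through [a] and [a']. With [a = a'], the positive [v a b] all
   come from one ray. *)
have v_far a a' b b' : (val (f b)).1 != (val (f b')).1 ->
    v a b + v a' b' <= mdist a a'.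
  move=> /negPf bb'; have := f1 b b'; rewrite /spine_dist bb'.
  have := metric_triangle (val b) a (val b').
  have := metric_triangle a a' (val b').
  by rewrite /v (metric_sym (val b) a); lra.
have /choice[s sP] a : exists s, forall b, 0 < v a b -> (val (f b)).1 = s.
  have [[b vb]|nov] := pselect (exists b, 0 < v a b); last first.
    (* Here [t a] will be 0, so the default label is harmless. *)
    by exists i0 => b vb; case: nov; exists b.
  exists (val (f b)).1 => b1 vb1; apply/eqP; apply: contraT => b1b.
  by have := v_far a a b1 b b1b; rewrite mdistxx; lra.
exists (fun a => ray (s a) (t a) (t0 a)).
  apply/LLipschitz1P => a a'; rewrite mdist_ray_ray /spine_dist /=.
  case: eqVneq => [_|ss].
    rewrite ler_norml t_lip andbT.
    by have := t_lip a' a; rewrite (metric_sym a'); lra.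
  have v_sum b b' : 0 < v a b -> 0 < v a' b' -> v a b + v a' b' <= mdist a a'.
    by move=> vb vb'; apply: v_far; rewrite (sP a)// (sP a').
  have no_v a1 : ~ (exists b, 0 < v a1 b) -> t a1 <= 0.
    by move=> nov; apply: t_le => // b vb; case: nov; exists b.
  have [[b vb]|/no_v ta] := pselect (exists b, 0 < v a b); last first.
    by have := t_lip a' a; rewrite (metric_sym a'); lra.
  have [[b' vb']|/no_v ta'] := pselect (exists b', 0 < v a' b'); last first.
    by have := t_lip a a'; lra.
  (* The bound on [t a + t a'] is obtained by taking the two suprema in turn; the witnesses [b] and
     [b'] show that the intermediate bounds are nonnegative, as [t_le] demands. *)
  have t'_le b1 : 0 < v a b1 -> t a' <= mdist a a' - v a b1.
    move=> vb1; apply: t_le => [|b2 vb2].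
      by have := v_sum _ _ vb1 vb'; lra.
    by have := v_sum _ _ vb1 vb2; lra.
  rewrite -lerBrDr; apply: t_le => [|b1 vb1].
    by have := t'_le _ vb; lra.
  by have := t'_le _ vb1; lra.
move=> b; apply: mdist_positivity; rewrite metric_sym mdist_ray.
have tE : t (val b) = (val (f b)).2.
  apply/eqP; rewrite eq_le; apply/andP; split.
    apply: t_le => // b' _; have := fB b' b.
    by rewrite /v (metric_sym (val b)); lra.
  by have := tv (val b) b; rewrite /v mdistxx subr0.
rewrite /spine_dist /= tE subrr normr0; case: eqVneq => // fs.
(* A positive height makes [v (val b) b] positive, so [s] names the ray of [f b]; at height 0 the
   labels do not matter. *)
have [fb|fb] := ltP 0 (val (f b)).2; last by have := f0 b; lra.
by case/eqP: fs; apply: sP; rewrite /v mdistxx subr0.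
Qed.

End hedgehog_metric.

(** * The surjection from the hedgehog, and the equivalence *)

Lemma Lipschitz_connected_hedgehog (R : realType) (X : metricType R) (x0 : X) :
  Lipschitz_connected X -> Lipschitz_image (hedgehog R x0) X.
Proof.
move=> Xc.
have /choice[c cP] x := Lipschitz_connected_path _ _ x0 x Xc.
exists (fun p : hedgehog R x0 => c (val p).1 (val p).2).
  apply/LipschitzP; exists 1 => // p q; rewrite mul1r hedgehog_mdistE.
  have p0 := height_ge0 _ p; have q0 := height_ge0 _ q.
  rewrite /spine_dist; case: eqVneq => [->|_].
    by case: (cP (val q).1).
  have [cp cp0 _] := cP (val p).1; have [cq cq0 _] := cP (val q).1.
  apply: le_trans (metric_triangle _ x0 _) _; apply: lerD.
    by rewrite -[X in mdist _ X]cp0 (le_trans (cp _ _))// subr0 ger0_norm.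
  by rewrite -[X in mdist X _]cq0 (le_trans (cq _ _))// sub0r normrN ger0_norm.
move=> x _; have [_ c0 [t t0 ct]] := cP x.
exists (ray x0 x t t0) => //=; case: eqVneq => [t00|//].
(* At time 0 the point carries the label [x0] instead of [x], but both paths start at [x0], which is
   then [x]. *)
have [_ c00 _] := cP x0.
by rewrite -ct t00 c0 c00.
Qed.

Theorem theorem1p2 (R : realType) (X : metricType R)
    (X_nonempty : [set: X] !=set0) :
  [<-> exists2 Y : metricType R, injective_space Y & Lipschitz_image Y X;
       exists2 T : metricType R, complete_space T /\ Rtree T & Lipschitz_image T X;
       Lipschitz_connected X].
Proof.
have [x0 _] := X_nonempty.
tfae.
(* The tree is not built from [Y]: this implication passes through the Lipschitz connectedness of
   [X]. *)
- move=> [Y Yinj YX]; exists (hedgehog R x0).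
    by split; [exact: hedgehog_complete|exact: hedgehog_Rtree].
  apply: Lipschitz_connected_hedgehog; apply: Lipschitz_image_connected YX.
  exact: injective_Lipschitz_connected.
- move=> [T [_ Ttree] TX]; apply: Lipschitz_image_connected TX.
  exact: Rtree_Lipschitz_connected.
- move=> Xc; exists (hedgehog R x0); first exact: hedgehog_injective.
  exact: Lipschitz_connected_hedgehog.
Qed.
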